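(* Consider an instance of the static dial-a-ride problem described in the context, let $l \in P$ be a rider and let $v \in V$ be a vehicle such that $$u^v_0 + t_{0,l} - e_l > p_l .$$ Then every feasible solution in which rider $l$ is assigned to vehicle $v$ (that is, $\sum_{j \in \mathcal{N}} x^v_{lj} = 1$) is suboptimal, i.e. there exists a feasible solution with strictly smaller objective value.
   Context: **Static dial-a-ride problem: data.** There is a finite set $V$ of vehicles. Each $v \in V$ has a tuple $(u^v_0, w^v_0, I_v, T^B_v, T^E_v, Q_v)$, where $u^v_0$ is the (given) time at which $v$ arrives at its departing stop, i.e. at the source node $0$; $w^v_0$ is the (given) number of passengers currently in $v$; $I_v$ is the set of dropoff nodes of the passengers on board $v$; $T^B_v$ and $T^E_v$ are the start and end times of the vehicle; $Q_v$ is its capacity. There is a complete directed graph $\mathcal{G} = (\mathcal{N}, \mathcal{A})$ whose nodes are: pickup nodes $P = \{1,\dots,n\}$; the associated dropoff nodes $D = \{n+1,\dots,2n\}$ (the dropoff of $i \in P$ is $n+i$); the dropoff nodes $I = \bigcup_{v \in V} I_v$ of the passengers already inside vehicles; a source $0$; and a sink $s$. Elements of $P$ are identified with requests (riders). Each node $i$ has a number of people $q_i$ to pick up ($q_i > 0$) or drop off ($q_i < 0$) and a service time $\Delta_i \ge 0$, with $q_i = -q_{n+i}$ for $i \in P$, and $q_i = \Delta_i = 0$ for the source and the sink. Each $i \in P$ has an earliest possible pickup time $e_i$ and a penalty $p_i$ for not being served. Each $i \in I$ has a given time $u^P_i$ at which the passenger was picked up. Each $i \in P \cup I$ has a shortest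 travel time $t_i$ from the request's origin to its destination. Travel times $(t_{i,j})_{(i,j)\in\mathcal{A}}$ (also written $t_{ij}$) satisfy the triangle inequality. Constants $\alpha, \beta$ bound the deviation from the shortest path. All times are measured from the start $0$ of the time horizon, so times and travel times are nonnegative. **Variables.** For $v \in V$ and $i,j \in \mathcal{N}$: $x^v_{ij} \in \{0,1\}$ indicates whether edge $(i,j)$ is used by $v$; $u^v_i$ is the time at which $v$ arrives at node $i$; $w^v_i$ is the number of people in $v$ when it leaves $i$ (with $u^v_0, w^v_0$ the given input values); $z_i$ ($i \in P$) equals $1$ if request $i$ is not served and $0$ otherwise. **Objective.** Minimize $$\sum_{i \in P}\sum_{v \in V} (u^v_i - e_i) + \sum_{i \in P} p_i z_i .$$ **Constraints** (defining feasible solutions): - $\left(\sum_{v \in V}\sum_{j \in \mathcal{N}} x^v_{ij}\right) + z_i = 1$ for all $i \in P$; - $\sum_{j \in \mathcal{N}} x^v_{ij} = \sum_{j \in \mathcal{N}} x^v_{ji}$ for all $i \in \mathcal{N} \setminus \{0,s\}$, $v \in V$; - $\sum_{j \in \mathcal{N}} x^v_{0j} = 1$ and $\sum_{j \in \mathcal{N}} x^v_{js} = 1$ for all $v \in V$; - $\sum_{j \in \mathcal{N}} x^v_{ij} - \sum_{j \in \mathcal{N}} x^v_{n+i,j} = 0$ for all $i \in P$, $v \in V$; - $\sum_{i \in \mathcal{N}} x^v_{ij} = 1$ for all $j \in I_v$, $v \in V$; - $u^v_j \ge (u^v_i + \Delta_i + t_{ij}) x^v_{ij}$ for all $i,j \in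 \mathcal{N}$, $v \in V$; - $u^v_0 \ge T^B_v$ and $u^v_s \le T^E_v$ for all $v \in V$; - $u^v_i \ge e_i$ for all $i \in P$, $v \in V$; - $t_i \le u^v_{n+i} - (u^v_i + \Delta_i) \le \max\{\alpha t_i, \beta + t_i\}$ for all $i \in P$, $v \in V$; - $t_i \le u^v_i - (u^P_i + \Delta_i) \le \max\{\alpha t_i, \beta + t_i\}$ for all $i \in I_v$, $v \in V$; - $w^v_j \ge (w^v_i + q_j) x^v_{ij}$ for all $i,j \in \mathcal{N}$, $v \in V$; - $0 \le w^v_i \le Q_v$ for all $i \in \mathcal{N}$, $v \in V$; - $x^v_{ij} \in \{0,1\}$ for all $i,j \in \mathcal{N}$, $v \in V$. **Conventions.** For each vehicle $v$, the edges with $x^v_{ij}=1$ form the route of $v$: a path from the source $0$ to the sink $s$ visiting each node at most once, with the pickup of each served request preceding its dropoff. The nodes of $I_v$ are dropoffs of passengers physically on board $v$ (so $w^v_0 = -\sum_{i \in I_v} q_i$, the sets $I_v$ are pairwise disjoint, and nodes of $I_v$ are visited only by $v$). *)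

(* Defs.v *)
From HB Require Import structures.
From mathcomp Require Import all_boot all_order all_algebra.

Set Implicit Arguments.
Unset Strict Implicit.
Unset Printing Implicit Defensive.

Import Order.TTheory GRing.Theory Num.Theory.
Local Open Scope ring_scope.

(* [Pickup i] and [Dropoff i] are the nodes i and n + i of the usual numbering,
   with i ranging over 0, ..., n-1; [Onboard k] is the dropoff node of a
   passenger k who is already inside a vehicle. *)
Inductive node (n : nat) (I : Type) : Type :=
  | Source
  | Pickup of 'I_n
  | Dropoff of 'I_n
  | Onboard of I
  | Sink.

Arguments Source {n I}.
Arguments Pickup {n I} i.
Arguments Dropoff {n I} i.
Arguments Onboard {n I} k.
Arguments Sink {n I}.

Definition node_code (n : nat) (I : Type) (a : node n I)
    : (bool + ('I_n + 'I_n)) + I :=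
  match a with
  | Source => inl (inl false)
  | Sink => inl (inl true)
  | Pickup i => inl (inr (inl i))
  | Dropoff i => inl (inr (inr i))
  | Onboard k => inr k
  end.

Definition node_decode (n : nat) (I : Type)
    (c : (bool + ('I_n + 'I_n)) + I) : node n I :=
  match c with
  | inl (inl b) => if b then Sink else Source
  | inl (inr (inl i)) => Pickup i
  | inl (inr (inr i)) => Dropoff i
  | inr k => Onboard k
  end.

Lemma node_codeK (n : nat) (I : Type) :
  cancel (@node_code n I) (@node_decode n I).
Proof. by case. Qed.

HB.instance Definition _ (n : nat) (I : finType) :=
  Finite.copy (node n I) (can_type (@node_codeK n I)).

(* The arcs of the complete digraph are the pairs of distinct nodes, so
   [travel_time] is unconstrained on the diagonal. *)
Record darp (R : realFieldType) (n : nat) (I V : finType) := Darp {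
  arrival0 : V -> R;                         (* u^v_0 *)
  load0 : V -> int;                          (* w^v_0 *)
  onboard : V -> {set I};                    (* I_v *)
  start_time : V -> R;                       (* T^B_v *)
  end_time : V -> R;                         (* T^E_v *)
  capacity : V -> int;                       (* Q_v *)
  demand : node n I -> int;                  (* q_i *)
  service : node n I -> R;                   (* Delta_i *)
  earliest : 'I_n -> R;                      (* e_i *)
  penalty : 'I_n -> R;                       (* p_i *)
  picked_up : I -> R;                        (* u^P_i *)
  shortest_request : 'I_n -> R;              (* t_i, i in P *)
  shortest_onboard : I -> R;                 (* t_i, i in I *)
  travel_time : node n I -> node n I -> R;   (* t_{i,j} *)
  alpha : R;
  beta : R;

  arrival0_ge0 : forall v, 0 <= arrival0 v;
  start_time_ge0 : forall v, 0 <= start_time v;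
  end_time_ge0 : forall v, 0 <= end_time v;
  service_ge0 : forall a, 0 <= service a;
  earliest_ge0 : forall i, 0 <= earliest i;
  picked_up_ge0 : forall k, 0 <= picked_up k;
  shortest_request_ge0 : forall i, 0 <= shortest_request i;
  shortest_onboard_ge0 : forall k, 0 <= shortest_onboard k;
  travel_time_ge0 : forall a b, a != b -> 0 <= travel_time a b;
  travel_time_triangle : forall a b c, a != b -> b != c -> a != c ->
    travel_time a c <= travel_time a b + travel_time b c;

  onboard_cover : \bigcup_v onboard v = [set: I];
  onboard_disjoint : forall v v', v != v' ->
    [disjoint onboard v & onboard v'];

  demand_pickup : forall i, 0 < demand (Pickup i);
  demand_dropoff : forall i, demand (Dropoff i) = - demand (Pickup i);
  demand_onboard : forall k, demand (Onboard k) < 0;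
  demand_source : demand Source = 0;
  demand_sink : demand Sink = 0;
  service_source : service Source = 0;
  service_sink : service Sink = 0;
  load0E : forall v, load0 v = - \sum_(k in onboard v) demand (Onboard k)
}.

(* The 0/1 variables are booleans, coerced to numbers where needed. *)
Record solution (R : realFieldType) (n : nat) (I V : finType) := Solution {
  edge : V -> node n I -> node n I -> bool;  (* x^v_{ij} *)
  arrival : V -> node n I -> R;              (* u^v_i *)
  load : V -> node n I -> int;               (* w^v_i *)
  unserved : 'I_n -> bool                    (* z_i *)
}.

Definition objective (R : realFieldType) (n : nat) (I V : finType)
    (d : darp R n I V) (s : solution R n I V) : R :=
  \sum_(i < n) \sum_v (arrival s v (Pickup i) - earliest d i)
  + \sum_(i < n) penalty d i * (unserved s i)%:R.

(* [r] lists the nodes of a simple path after its initial node [Source]; the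
   consecutive pairs of that path are the members of [zip (Source :: r) r]. *)
Definition is_route (n : nat) (I : finType)
    (x : node n I -> node n I -> bool) (r : seq (node n I)) : Prop :=
  [/\ last Source r = Sink,
      uniq (Source :: r),
      (forall a b, x a b = ((a, b) \in zip (Source :: r) r)) &
      (forall i, Pickup i \in r ->
         (index (Pickup i) r < index (Dropoff i) r < size r)%N)].

Record feasible (R : realFieldType) (n : nat) (I V : finType)
    (d : darp R n I V) (s : solution R n I V) : Prop := Feasible {
  feas_arrival0 : forall v, arrival s v Source = arrival0 d v;
  feas_load0 : forall v, load s v Source = load0 d v;
  feas_served : forall i,
    (\sum_v \sum_b edge s v (Pickup i) b + unserved s i = 1)%N;
  feas_flow : forall v a, a != Source -> a != Sink ->
    (\sum_b edge s v a b = \sum_b edge s v b a)%N;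
  feas_source : forall v, (\sum_b edge s v Source b = 1)%N;
  feas_sink : forall v, (\sum_b edge s v b Sink = 1)%N;
  feas_pairing : forall v i,
    (\sum_b edge s v (Pickup i) b = \sum_b edge s v (Dropoff i) b)%N;
  feas_onboard : forall v k, k \in onboard d v ->
    (\sum_a edge s v a (Onboard k) = 1)%N;
  feas_time : forall v a b,
    (arrival s v a + service d a + travel_time d a b) * (edge s v a b)%:R
      <= arrival s v b;
  feas_start : forall v, start_time d v <= arrival s v Source;
  feas_end : forall v, arrival s v Sink <= end_time d v;
  feas_earliest : forall v i, earliest d i <= arrival s v (Pickup i);
  feas_ride_request : forall v i,
    shortest_request d i
      <= arrival s v (Dropoff i) - (arrival s v (Pickup i)
                                    + service d (Pickup i))
      <= Num.max (alpha d * shortest_request d i)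
                 (beta d + shortest_request d i);
  feas_ride_onboard : forall v k, k \in onboard d v ->
    shortest_onboard d k
      <= arrival s v (Onboard k) - (picked_up d k + service d (Onboard k))
      <= Num.max (alpha d * shortest_onboard d k)
                 (beta d + shortest_onboard d k);
  feas_load : forall v a b,
    (load s v a + demand d b) * (edge s v a b)%:R <= load s v b;
  feas_capacity : forall v a, 0 <= load s v a <= capacity d v;
  feas_route : forall v, exists r, is_route (edge s v) r;
  feas_onboard_only : forall v v' k, k \in onboard d v -> v' != v ->
    (\sum_a edge s v' a (Onboard k) = 0)%N
}.

(* Main.v *)
(* Cancel rider l: shortcut the route of v past the pickup and the dropoff of l,
   and reset the arrival time at the pickup to its least value e_l, shifting
   the one at the dropoff by the same amount. The triangle inequality keeps the
   other arrival times valid, and applied along the old route it also gives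
   u^v_l >= u^v_0 + t_{0,l}; so the objective drops by
   u^v_l - e_l - p_l > 0. The loads between the two removed nodes may have to
   decrease: the new load at a node of the route is the exact number of people
   in v, which is nonnegative since every dropoff either belongs to a passenger
   on board at the start or is preceded by its pickup. *)
Require Import Defs.
From mathcomp Require Import all_boot all_order all_algebra.
From mathcomp Require Import zify lra.
Set Implicit Arguments.
Unset Strict Implicit.
Unset Printing Implicit Defensive.

Import Order.TTheory GRing.Theory Num.Theory.
Local Open Scope ring_scope.

(** * Consecutive pairs and positions in sequences *)

Lemma path_zip (T : eqType) (e : rel T) (x : T) (r : seq T) :
  path e x r = all (fun p => e p.1 p.2) (zip (x :: r) r).
Proof. by elim: r x => //= y r IHr x; rewrite IHr. Qed.

Lemma mem_zip2 (S T : eqType) (s : seq S) (t : seq T) (a : S) (b : T) :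
  (a, b) \in zip s t -> (a \in s) && (b \in t).
Proof.
elim: s t => [|x s IHs] [|y t] //=.
rewrite !inE => /orP[/eqP[-> ->]|/IHs/andP[-> ->]]; rewrite ?eqxx //.
by rewrite !orbT.
Qed.

Lemma uniq_zip_neq (T : eqType) (x : T) (r : seq T) (a b : T) :
  uniq (x :: r) -> (a, b) \in zip (x :: r) r -> a != b.
Proof.
elim: r x => [|y r IHr] x //= /andP[xNr Ur].
rewrite inE => /orP[/eqP[-> ->]|]; last exact: IHr.
by apply: contraNneq xNr => ->; rewrite mem_head.
Qed.

Lemma index_zip (T : eqType) (x : T) (r : seq T) (a b : T) :
  uniq (x :: r) -> (a, b) \in zip (x :: r) r ->
  index b (x :: r) = (index a (x :: r)).+1.
Proof.
elim: r x => [|y r IHr] x //= /andP[xNr Ur].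
rewrite inE => /orP[/eqP[-> ->]|ab].
  by rewrite !eqxx; case: eqP xNr => // <-; rewrite mem_head.
have /andP[ayr br] := mem_zip2 ab.
have xNa : x != a by apply: contraNneq xNr => ->.
have xNb : x != b by apply: contraNneq xNr => ->; rewrite inE br orbT.
by have /= -> := IHr y Ur ab; rewrite (negPf xNa) (negPf xNb).
Qed.

(** A head failing [p] differs from both [x] and [y], so deleting it shifts both indices alike. *)
Lemma index_filter_leq (T : eqType) (p : pred T) (s : seq T) (x y : T) :
  p x -> p y ->
  (index x (filter p s) <= index y (filter p s))%N = (index x s <= index y s)%N.
Proof.
move=> px py; elim: s => //= z s IHs.
case: ifP => [pz|/negbT Npz] /=; first by case: (z == x) (z == y) => [] [].
by rewrite !ifN ?ltnS //; apply: contraNneq Npz => ->.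
Qed.

Lemma index_filter_ltn (T : eqType) (p : pred T) (s : seq T) (x y : T) :
  p x -> p y ->
  (index x (filter p s) < index y (filter p s))%N = (index x s < index y s)%N.
Proof. by move=> px py; rewrite !ltnNge index_filter_leq. Qed.

Lemma sum_zip_out (T : finType) (x : T) (r : seq T) (a : T) :
  uniq (x :: r) ->
  (\sum_b ((a, b) \in zip (x :: r) r) = (a \in belast x r))%N.
Proof.
elim: r x => [|y r IHr] x /=; first by rewrite big1.
case/andP=> xNr Ur; rewrite inE.
have [->|aNx] := eqVneq a x; last first.
  by rewrite -IHr //; apply: eq_bigr => b _; rewrite inE xpair_eqE (negPf aNx).
rewrite (bigD1 y) //= inE eqxx big1 // => b bNy.
rewrite inE xpair_eqE (negPf bNy) andbF /=.
by case: (boolP (_ \in _)) => // /mem_zip2; rewrite (negPf xNr).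
Qed.

Lemma sum_zip_in (T : finType) (x : T) (r : seq T) (b : T) :
  uniq (x :: r) ->
  (\sum_a ((a, b) \in zip (x :: r) r) = (b \in r))%N.
Proof.
elim: r x => [|y r IHr] x /=; first by rewrite big1.
case/andP=> xNr Ur; rewrite inE.
have [->|bNy] := eqVneq b y; last first.
  rewrite -(IHr y) //; apply: eq_bigr => a _.
  by rewrite inE xpair_eqE (negPf bNy) andbF.
rewrite (bigD1 x) //= inE eqxx big1 // => a aNx.
rewrite inE xpair_eqE (negPf aNx) /=.
case/andP: Ur => yNr _; case: (boolP (_ \in _)) => // /mem_zip2.
by rewrite (negPf yNr) andbF.
Qed.

(** * Prefix sums of demands along a path *)

(** For [b] outside [s], [index b s] is [size s], so every element of [s] is counted. Summing over
    the type [T] allows regrouping by kind of node. *)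
Definition prefix_sum (T : finType) (q : T -> int) (s : seq T) (b : T) : int :=
  \sum_(c | (c \in s) && (index c s <= index b s)%N) q c.

Lemma prefix_sum_head (T : finType) (q : T -> int) (x : T) (r : seq T) :
  prefix_sum q (x :: r) x = q x.
Proof.
rewrite /prefix_sum (big_pred1 x) // => c /=.
by rewrite eqxx inE eq_sym; case: eqP => //=; rewrite andbF.
Qed.

Lemma prefix_sum_zip (T : finType) (q : T -> int) (x : T) (r : seq T) (a b : T) :
  uniq (x :: r) -> (a, b) \in zip (x :: r) r ->
  prefix_sum q (x :: r) b = prefix_sum q (x :: r) a + q b.
Proof.
move=> Ur ab; have Eb := index_zip Ur ab.
have /andP[axr br] := mem_zip2 ab.
have bxr : b \in x :: r by rewrite inE br orbT.
rewrite /prefix_sum (bigD1 b) /= ?bxr ?leqnn // addrC; congr (_ + _).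
apply: eq_bigl => c; rewrite -andbA; case: (boolP (c \in x :: r)) => //= cxr.
(* Distinct elements have distinct indices, so [!=] and [<=] combine into [<], that is, a position
   at most that of [a]. *)
have -> : (c != b) = (index c (x :: r) != index b (x :: r)).
  by congr negb; apply/eqP/eqP => [->//|]; apply: index_inj.
by move: Eb => /= ->; rewrite andbC -ltn_neqAle ltnS.
Qed.

Lemma prefix_sum_filter (T : finType) (q : T -> int) (p : pred T) (s : seq T)
    (b : T) :
  p b ->
  prefix_sum q (filter p s) b
    = \sum_(c | p c && ((c \in s) && (index c s <= index b s)%N)) q c.
Proof.
move=> pb; apply: eq_bigl => c; rewrite mem_filter -andbA.
by case: (boolP (p c)) => //= pc; rewrite index_filter_leq.
Qed.

(** * Sums over nodes and degrees along a route *)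

(** The two ends of a request are paired because their demands cancel, so loads can be compared one
    request at a time. *)
Lemma sum_node (n : nat) (I : finType) (F : node n I -> int) :
  \sum_a F a = F Source + F Sink + \sum_i (F (Pickup i) + F (Dropoff i))
               + \sum_k F (Onboard k).
Proof.
rewrite (reindex (@node_decode n I)) /=; last first.
  exists (@node_code n I) => [[[[]|[]]|]|a _] //; exact: node_codeK.
rewrite !big_sumType /= big_bool /= big_split /=.
by rewrite [F Sink + _]addrC !addrA.
Qed.

Section Route.
Context (n : nat) (I : finType) (x : node n I -> node n I -> bool).
Context (r : seq (node n I)) (x_r : is_route x r).

Lemma route_out a : (\sum_b x a b = (a \in Source :: r) && (a != Sink))%N.
Proof.
case: x_r => lst Ur E _; under eq_bigr do rewrite E.
(* [lastI] splits off the final node [Sink], the only node of the path without a successor. *)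
rewrite sum_zip_out // lastI lst mem_rcons inE.
move: Ur; rewrite lastI lst rcons_uniq => /andP[NS _].
by have [->|//] := eqVneq a Sink; rewrite ?(negPf NS) ?andbT.
Qed.

Lemma route_in b : (\sum_a x a b = (b \in r))%N.
Proof.
by case: x_r => _ Ur E _; under eq_bigr do rewrite E; rewrite sum_zip_in.
Qed.

Lemma route_path (e : rel (node n I)) :
  (forall a b, x a b -> e a b) -> path e Source r.
Proof.
case: x_r => _ _ E _ He; rewrite path_zip; apply/allP => -[a b] ab /=.
by apply: He; rewrite E.
Qed.

(** A predicate treating both ends of a request alike never keeps a pickup without its dropoff, and
    filtering preserves their order. *)
Lemma route_filter (p : pred (node n I)) :
  p Sink -> (forall i, p (Pickup i) = p (Dropoff i)) ->
  is_route (fun a b => (a, b) \in zip (Source :: filter p r) (filter p r))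
           (filter p r).
Proof.
case: x_r => lst Ur _ Hi pS pPD; split => //.
- case/lastP: r lst => // r0 z; rewrite last_rcons => ->.
  by rewrite filter_rcons pS last_rcons.
- by case/andP: Ur => S0 Ur /=; rewrite filter_uniq // mem_filter (negPf S0) andbF.
move=> i; rewrite mem_filter => /andP[pi /Hi/andP[lt1 lt2]].
rewrite index_filter_ltn // -?pPD // lt1 index_mem mem_filter -pPD pi.
by rewrite -index_mem.
Qed.

End Route.

(** * Removing a rider from a route: arrival times *)

Definition kept (n : nat) (I : finType) (l : 'I_n) (a : node n I) : bool :=
  (a != Pickup l) && (a != Dropoff l).

Lemma kept_dropoff (n : nat) (I : finType) (l i : 'I_n) :
  kept l (Dropoff i : node n I) = kept l (Pickup i : node n I).
Proof. by rewrite /kept andbC. Qed.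

(** Here [i] and [j] are the positions of pickup and dropoff, [k] the current one: a request past
    its dropoff is past its pickup, so it contributes [q] or 0. *)
Lemma pair_load_ge0 (q : int) (b : bool) (i j k : nat) :
  0 <= q -> (b -> i < j)%N ->
  0 <= (if b && (i <= k)%N then q else 0) + (if b && (j <= k)%N then - q else 0).
Proof. by case: b => //= q0 /(_ isT) ij; do 2![case: ifP]; lia. Qed.

Section DropRider.
Context (R : realFieldType) (n : nat) (I V : finType) (d : darp R n I V).
Context (s : solution R n I V) (d_s : feasible d s).
Context (l : 'I_n) (v : V) (r : seq (node n I)).
Context (s_r : is_route (edge s v) r).

Local Notation u := (arrival s v).
Local Notation rl := (filter (kept l) r).

(* The disjunct [a == b] makes the relation transitive although [travel_time] is
   unconstrained on the diagonal. *)
Let reach : rel (node n I) :=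
  fun a b => (a == b) || (u a + service d a + travel_time d a b <= u b).

Lemma reach_trans : transitive reach.
Proof.
move=> b a c; rewrite /reach.
have [->//|aNb] := eqVneq a b.
have [<-|bNc] := eqVneq b c; first by rewrite (negPf aNb).
have [//|aNc] := eqVneq a c; move=> /= ab bc.
have := travel_time_triangle d aNb bNc aNc; have := service_ge0 d b.
lra.
Qed.

Lemma reach_path : path reach Source r.
Proof.
apply: (route_path s_r) => a b ab; have := feas_time d_s v a b.
by rewrite ab mulr1 /reach => ->; rewrite orbT.
Qed.

(** By transitivity [reach] relates [Source] to every later node; [Source] does not recur, which
    excludes the equality disjunct. *)
Lemma arrival_ge_direct (b : node n I) :
  b \in r -> arrival0 d v + travel_time d Source b <= u b.
Proof.
move=> br; have /allP/(_ b br) := order_path_min reach_trans reach_path.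
have [_ /= /andP[/negP S0 _] _ _] := s_r; case/orP => [/eqP SE|].
  by case: S0; rewrite SE.
by rewrite service_source addr0 (feas_arrival0 d_s).
Qed.

(** A subsequence of a path for a transitive relation is again a path; uniqueness rules out the
    equality disjunct. *)
Lemma filter_arrival (a b : node n I) :
  (a, b) \in zip (Source :: rl) rl ->
  u a + service d a + travel_time d a b <= u b.
Proof.
move=> ab; have [_ Ur _ _] := s_r.
have := subseq_path reach_trans (filter_subseq (kept l) r) reach_path.
rewrite path_zip => /allP/(_ _ ab) /= /orP[/eqP aEb|//].
have Url : uniq (Source :: rl) by have := filter_uniq (kept l) Ur.
by have := uniq_zip_neq Url ab; rewrite aEb eqxx.
Qed.

Lemma route_dropoff (i : 'I_n) : (Dropoff i \in r) = (Pickup i \in r).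
Proof.
have := feas_pairing d_s v i; rewrite !(route_out s_r) !inE /= !andbT.
by case: (_ \in r) (_ \in r) => [] [].
Qed.

Lemma route_onboard (k : I) : (Onboard k \in r) = (k \in onboard d v).
Proof.
have := route_in s_r (Onboard k); case: (boolP (k \in onboard d v)) => kv.
  by rewrite (feas_onboard d_s) //; case: (_ \in r).
(* Otherwise [k] is on board another vehicle, and only that one may visit its dropoff. *)
have : k \in \bigcup_v onboard d v by rewrite onboard_cover.
case/bigcupP => v' _ kv'; rewrite (feas_onboard_only d_s kv').
  by case: (_ \in r).
by apply: contraNneq kv => ->.
Qed.

Lemma filter_route : is_route (fun a b => (a, b) \in zip (Source :: rl) rl) rl.
Proof. by apply: (route_filter s_r) => // i; rewrite kept_dropoff. Qed.

Lemma filter_cons : Source :: rl = filter (kept l) (Source :: r).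
Proof. by []. Qed.

(** * Exact loads along the shortened route *)

Local Notation new_load a :=
  (load0 d v + prefix_sum (demand d) (Source :: rl) a).

Lemma prefix_load_ge0 (a : node n I) : 0 <= new_load a.
Proof.
have [_ _ _ pd] := filter_route.
rewrite /prefix_sum big_mkcond /= sum_node demand_source demand_sink.
rewrite !if_same !add0r load0E.
set on := \sum_(k in _) _; set req := \sum_i _; set ons := \sum_k _.
have req_ge0 : 0 <= req.
  apply: sumr_ge0 => i _; have qi := demand_pickup d i.
  rewrite demand_dropoff !in_cons /= !mem_filter route_dropoff.
  rewrite kept_dropoff.
  apply: pair_load_ge0 => [|ir]; first exact: ltW.
  have /pd/andP[lt1 _] : Pickup i \in rl by rewrite mem_filter.
  by rewrite ltnS.
(* Onboard demands are negative, so the dropoffs passed so far sum to at least the sum over all of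
   [onboard d v], which is [- load0 d v]. *)
have ons_ge : on <= ons.
  rewrite /on big_mkcond; apply: ler_sum => k _; have qk := demand_onboard d k.
  rewrite in_cons mem_filter route_onboard /=.
  by case: (k \in _) => //=; case: ifP => _ //; lia.
lia.
Qed.

Lemma prefix_load_old (a : node n I) : a \in Source :: r ->
  load0 d v + prefix_sum (demand d) (Source :: r) a <= load s v a.
Proof.
have [_ Ur E _] := s_r.
(* The surplus of the given load over the exact one increases along the route. *)
pose e : rel (node n I) := fun a b =>
  load s v a - prefix_sum (demand d) (Source :: r) a
  <= load s v b - prefix_sum (demand d) (Source :: r) b.
have e_trans : transitive e by move=> b a' c; apply: le_trans.
have e_path : path e Source r.
  apply: (route_path s_r) => b c bc; rewrite /e.
  rewrite (prefix_sum_zip _ Ur (_ : (b, c) \in _)) -?E //.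
  have := feas_load d_s v b c; rewrite bc mulr1.
  by rewrite opprD addrA addrAC lerD2r lerBrDr.
have W0 := prefix_sum_head (demand d) Source r.
rewrite demand_source in W0; have L0 := feas_load0 d_s v.
rewrite inE => /orP[/eqP->|ar]; first by rewrite W0 L0; lia.
have /allP/(_ a ar) := order_path_min e_trans e_path.
by rewrite /e W0 L0; lia.
Qed.

(** The exact load on the old route lies in between: it exceeds the new one by the contribution of
    rider [l], nonnegative by [pair_load_ge0]. *)
Lemma prefix_load_le (a : node n I) :
  a \in Source :: rl -> new_load a <= load s v a.
Proof.
rewrite filter_cons mem_filter => /andP[ka ar].
apply: le_trans (prefix_load_old ar); rewrite lerD2l prefix_sum_filter //.
rewrite /prefix_sum big_mkcond [leRHS]big_mkcond /= !sum_node.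
have [_ _ _ pd] := s_r.
rewrite demand_source demand_sink !if_same !add0r.
apply: lerD; apply: ler_sum => i _ //.
have [->|iNl] := eqVneq i l; last first.
  by rewrite /kept !(inj_eq _) //; do ?[by move=> ? ? []]; rewrite iNl.
have ql := demand_pickup d l.
rewrite demand_dropoff /kept !eqxx /= addr0.
rewrite !in_cons /= route_dropoff.
by apply: pair_load_ge0 => [|/pd/andP[lt1 _]]; [apply: ltW | rewrite ltnS].
Qed.

(** * The modified solution, its feasibility and its cost *)

(** Earliest times and ride times constrain even riders whom a vehicle does not serve, so the shift
    at the dropoff keeps the ride time of [l]. Nodes off the new route keep their old loads, which
    respect the capacity. *)
Definition drop_rider : solution R n I V := Solution
  (fun v' a b => if v' == v then (a, b) \in zip (Source :: rl) rl
                 else edge s v' a b)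
  (fun v' a => if v' != v then arrival s v' a else
     if a == Pickup l then earliest d l
     else if a == Dropoff l
       then earliest d l + (u (Dropoff l) - u (Pickup l))
     else u a)
  (fun v' a => if (v' == v) && (a \in Source :: rl) then new_load a
               else load s v' a)
  (fun i => (i == l) || unserved s i).

(** Each degree vanishes or is that of [s], so the degree constraints reduce to those of [s]. *)
Lemma drop_rider_out (v' : V) (a : node n I) :
  (\sum_b edge drop_rider v' a b
     = if (v' == v) && ~~ kept l a then 0 else \sum_b edge s v' a b)%N.
Proof.
rewrite /=; case: eqP => //= ->; rewrite (route_out filter_route).
by rewrite filter_cons mem_filter (route_out s_r); case: (kept l a).
Qed.

Lemma drop_rider_in (v' : V) (b : node n I) :
  (\sum_a edge drop_rider v' a b
     = if (v' == v) && ~~ kept l b then 0 else \sum_a edge s v' a b)%N.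
Proof.
rewrite /=; case: eqP => //= ->; rewrite (route_in filter_route).
by rewrite mem_filter (route_in s_r); case: (kept l b).
Qed.

Context (l_v : (\sum_b edge s v (Pickup l) b = 1)%N).

Lemma unserved_assigned : unserved s l = false.
Proof.
have := feas_served d_s l; rewrite (bigD1 v) //= l_v.
by case: (unserved s l); lia.
Qed.

(** The edge of [v] already uses up the total of 1 in the service constraint of [l]; hence no
    vehicle serves [l] after the change. *)
Lemma edge_other_vehicle (v' : V) :
  v' != v -> (\sum_b edge s v' (Pickup l) b = 0)%N.
Proof.
move=> v'v; have := feas_served d_s l.
by rewrite (bigD1 v) //= l_v (bigD1 v') //=; lia.
Qed.

(** This is the time constraint on the loop at [b]: a route has no loops, so its left side is
    multiplied by 0. *)
Lemma arrival_ge0 (v' : V) (b : node n I) : 0 <= arrival s v' b.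
Proof.
have [r' [_ Ur E _]] := feas_route d_s v'.
have := feas_time d_s v' b b; suff -> : edge s v' b b = false by rewrite mulr0.
by apply/negP; rewrite E => /(uniq_zip_neq Ur); rewrite eqxx.
Qed.

Lemma drop_rider_arrival_ge0 (v' : V) (b : node n I) :
  0 <= arrival drop_rider v' b.
Proof.
rewrite /=; do !case: ifP => _; rewrite ?arrival_ge0 ?earliest_ge0 //.
(* At the dropoff of [l], the ride-time bound makes the added difference of arrivals nonnegative. *)
have /andP[] := feas_ride_request d_s v l.
have := shortest_request_ge0 d l; have := service_ge0 d (Pickup l).
by have := earliest_ge0 d l; lra.
Qed.

Lemma drop_rider_load_bounds (v' : V) (a : node n I) :
  0 <= load drop_rider v' a <= capacity d v'.
Proof.
have /andP[w0 wQ] := feas_capacity d_s v' a.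
rewrite /=; case: ifP => [/andP[/eqP v'v ar]|_]; last by rewrite w0 wQ.
rewrite prefix_load_ge0 (le_trans (prefix_load_le ar)) //.
by rewrite -v'v.
Qed.

Lemma drop_rider_feasible : feasible d drop_rider.
Proof.
have [rS Ur rE _] := filter_route.
have keptN (a : node n I) :
    kept l a -> (a == Pickup l) = false /\ (a == Dropoff l) = false.
  by case/andP=> /negPf-> /negPf->.
have keep_arrival v' a : kept l a -> arrival drop_rider v' a = arrival s v' a.
  by move=> /keptN[aP aD]; rewrite /= aP aD; case: eqP => //= ->.
have edgeE a b : edge drop_rider v a b = ((a, b) \in zip (Source :: rl) rl).
  by rewrite /= eqxx.
split.
- by move=> v'; rewrite keep_arrival // (feas_arrival0 d_s v').
- move=> v'; rewrite /= mem_head andbT; case: eqP => [->|_].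
    by rewrite prefix_sum_head demand_source addr0.
  exact: feas_load0 d_s v'.
- move=> i; under eq_bigr do rewrite drop_rider_out.
  have [->|iNl] := eqVneq i l.
    rewrite /= eqxx big1 // => v' _; rewrite /kept eqxx /=.
    by case: eqP => //= /eqP/edge_other_vehicle.
  rewrite -(feas_served d_s i) /= (negPf iNl); congr (_ + _)%N.
  apply: eq_bigr => v' _.
  suff -> : kept l (Pickup i : node n I) by rewrite andbF.
  by rewrite /kept andbT.
- move=> v' a aNS aNs; rewrite drop_rider_out drop_rider_in.
  by rewrite (feas_flow d_s v' aNS aNs).
- by move=> v'; rewrite drop_rider_out andbF; apply: feas_source d_s v'.
- by move=> v'; rewrite drop_rider_in andbF; apply: feas_sink d_s v'.
- move=> v' i; rewrite !drop_rider_out kept_dropoff.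
  by rewrite (feas_pairing d_s v' i).
- by move=> v' k kv; rewrite drop_rider_in andbF; apply: feas_onboard d_s v' k kv.
- move=> v' a b; case: (boolP (edge drop_rider v' a b)); last first.
    by move=> _; rewrite mulr0 drop_rider_arrival_ge0.
  rewrite mulr1; have [->|v'v] := eqVneq v' v; last first.
    rewrite /= (negPf v'v) => ab; have := feas_time d_s v' a b.
    by rewrite ab mulr1.
  rewrite edgeE => ab; have /andP[ar br] := mem_zip2 ab.
  move: ar br; rewrite filter_cons !mem_filter => /andP[ka _] /andP[kb _].
  by rewrite !keep_arrival // filter_arrival.
- by move=> v'; rewrite keep_arrival //; apply: feas_start d_s v'.
- by move=> v'; rewrite keep_arrival //; apply: feas_end d_s v'.
- move=> v' i; have := feas_earliest d_s v' i; rewrite /=.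
  case: (eqVneq v' v) => [->|_] //= e_i.
  by have [[->]|_] := eqVneq (Pickup i) (Pickup l).
- move=> v' i; have := feas_ride_request d_s v' i.
  have [->|iNl] := eqVneq i l; last first.
    have kP : kept l (Pickup i : node n I) by rewrite /kept andbT.
    by rewrite !keep_arrival // kept_dropoff.
  rewrite /=; case: (eqVneq v' v) => [->|_] //=.
  (* The shift cancels: the ride time of [l] in [v] is unchanged. *)
  rewrite !eqxx /=; set t := shortest_request d l; set m := Num.max _ _.
  by case/andP=> lo hi; apply/andP; split; lra.
- move=> v' k kv; rewrite keep_arrival //.
  exact: feas_ride_onboard d_s v' k kv.
- move=> v' a b; case: (boolP (edge drop_rider v' a b)); last first.
    by move=> _; rewrite mulr0; case/andP: (drop_rider_load_bounds v' b).
  rewrite mulr1; have [->|v'v] := eqVneq v' v; last first.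
    rewrite /= (negPf v'v) => ab; have := feas_load d_s v' a b.
    by rewrite ab mulr1.
  rewrite edgeE => ab; have /andP[ar br] := mem_zip2 ab.
  (* Along a used edge, exact loads satisfy the constraint with equality. *)
  rewrite /= eqxx ar inE br orbT (prefix_sum_zip _ Ur ab).
  by rewrite addrA.
- exact: drop_rider_load_bounds.
- move=> v'; rewrite /=; case: eqP => _; last exact: feas_route d_s v'.
  by exists rl; apply: filter_route.
- move=> v' v'' k kv' v''v'; rewrite drop_rider_in andbF.
  exact: feas_onboard_only d_s v' v'' k kv' v''v'.
Qed.

(** Only two terms change: the delay of [l] in [v] becomes 0, and [penalty d l] appears because [l]
    was served in [s]. *)
Lemma drop_rider_objective :
  objective d drop_rider
    = objective d s - (u (Pickup l) - earliest d l) + penalty d l.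
Proof.
rewrite /objective (bigD1 l) //= [in RHS](bigD1 l) //=.
rewrite (bigD1 v) //= [in RHS](bigD1 v) //= !eqxx /=.
rewrite [\sum_i penalty d i * _](bigD1 l) //=.
rewrite [in RHS](bigD1 l (F := fun i => penalty d i * _)) //= eqxx.
rewrite unserved_assigned subrr.
under eq_bigr => v' /negPf v'v do rewrite v'v.
have E2 : \sum_(i < n | i != l) \sum_v0 (arrival drop_rider v0 (Pickup i)
    - earliest d i) = \sum_(i < n | i != l) \sum_v0 (arrival s v0 (Pickup i)
    - earliest d i).
  apply: eq_bigr => i /negPf il; apply: eq_bigr => v' _; rewrite /=.
  by case: eqP => //= ->; have -> : (Pickup i == Pickup l :> node n I) = false.
have E3 : \sum_(i < n | i != l) penalty d i * ((i == l) || unserved s i)%:R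
        = \sum_(i < n | i != l) penalty d i * (unserved s i)%:R.
  by apply: eq_bigr => i /negPf ->.
move: E2 E3; rewrite /= => -> ->.
rewrite mulr0 mulr1; lra.
Qed.

End DropRider.

Unset Implicit Arguments.

Theorem theorem4p1 (R : realFieldType) (n : nat) (I V : finType)
    (d : darp R n I V) (l : 'I_n) (v : V) :
  arrival0 d v + travel_time d Source (Pickup l) - earliest d l > penalty d l ->
  forall s : solution R n I V,
    feasible d s ->
    (\sum_b edge s v (Pickup l) b = 1)%N ->
    exists s' : solution R n I V,
      feasible d s' /\ objective d s' < objective d s.
Proof.
move=> late s d_s l_v; have [r s_r] := feas_route d_s v.
exists (drop_rider d s l v r); split; first exact: drop_rider_feasible.
rewrite (drop_rider_objective d_s) //.
(* Out-degree 1 puts the pickup on the route, so the direct bound applies and, with [late], makes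
   the delay saved exceed the penalty. *)
have lr : Pickup l \in r.
  by move: l_v; rewrite (route_out s_r) !inE /= andbT; case: (_ \in r).
have := arrival_ge_direct d_s s_r lr; lra.
Qed.
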